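(* Let $q\in\mathbb C$ with $0<|q|<1$, $z\in\mathbb C\setminus\{0\}$, $x=\frac12(z+z^{-1})\neq0$, $\gamma,a,b,t\in\mathbb C\setminus\{0\}$ with $|at|<1$ and $|bt|<1$, and $\frac1{ab},-\gamma bt\notin\{q^{-k}:k\in\mathbb N_0\}$. Then the $q^{-1}$-Al-Salam--Chihara polynomials $Q_n(x;a,b|q^{-1})$ satisfy $$\sum_{n=0}^\infty\frac{t^n(\gamma;q)_n\,q^{\binom n2}\,Q_n(x;a,b|q^{-1})}{(q,\frac1{ab};q)_n}=\frac{(-\gamma bt;q)_\infty}{(-bt;q)_\infty}\;{}_3\phi_2\left(\gamma,\,\frac za,\,\frac1{az};\ \frac1{ab},\,-\gamma bt;\ q,-at\right).$$
   Context: $\mathbb N_0=\{0,1,2,\dots\}$. $(a;q)_n=\prod_{j=0}^{n-1}(1-aq^j)$ for $n\in\mathbb N_0\cup\{\infty\}$, $(a_1,\dots,a_k;q)_n=\prod_i(a_i;q)_n$, and $${}_r\phi_s(a_1,\dots,a_r;b_1,\dots,b_s;q,w)=\sum_{k\ge0}\frac{(a_1,\dots,a_r;q)_k}{(q,b_1,\dots,b_s;q)_k}\left((-1)^kq^{\binom k2}\right)^{1+s-r}w^k .$$ The $q^{-1}$-Al-Salam--Chihara polynomials, for $x=\frac12(z+z^{-1})$, are $$Q_n(x;a,b|q^{-1})=q^{-\binom n2}(-b)^n\left(\tfrac1{ab};q\right)_n\;{}_3\phi_1\left(q^{-n},\frac za,\frac1{az};\ \frac1{ab};\ q,\frac{q^na}b\right).$$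 *)

(* Defs.v *)
From HB Require Import structures.
From mathcomp Require Import all_boot all_order all_algebra.
From mathcomp Require Import ring complex.
From mathcomp Require Import all_classical all_reals all_analysis.

Set Implicit Arguments.
Unset Strict Implicit.
Unset Printing Implicit Defensive.

Import Order.TTheory GRing.Theory Num.Theory.
Import numFieldNormedType.Exports.

Local Open Scope classical_set_scope.
Local Open Scope ring_scope.

(* The analysis library puts the normed topology on [R[i]^o] (which is
   convertible to [R[i]]), so sequences are cast to [nat -> R[i]^o] wherever a
   limit is taken. *)

Definition qpoch (F : fieldType) (a q : F) (n : nat) : F :=
  \prod_(j < n) (1 - a * q ^+ j).

Definition qpochs (F : fieldType) (s : seq F) (q : F) (n : nat) : F :=
  \prod_(a <- s) qpoch a q n.

Definition qpoch_inf (R : realType) (a q : R[i]) : R[i] :=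
  limn (qpoch a q : nat -> R[i]^o).

(* The lengths of [s] and [s'] are the indices r and s of the basic
   hypergeometric series; 1 + s - r is an integer and may be negative. *)
Definition qhyper_term (F : fieldType) (s s' : seq F) (q w : F) (k : nat) : F :=
  qpochs s q k / qpochs (q :: s') q k
  * ((-1) ^+ k * q ^+ 'C(k, 2)) ^ (1 + (size s')%:Z - (size s)%:Z)
  * w ^+ k.

Definition qhyper_cvg (R : realType) (s s' : seq R[i]) (q w : R[i]) : Prop :=
  cvgn (series (qhyper_term s s' q w : nat -> R[i]^o)).

Definition qhyper (R : realType) (s s' : seq R[i]) (q w : R[i]) : R[i] :=
  limn (series (qhyper_term s s' q w : nat -> R[i]^o)).

Definition asc_form (R : realType) (n : nat) (z a b q : R[i]) : R[i] :=
  q ^- 'C(n, 2) * (- b) ^+ n * qpoch (a * b)^-1 q n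
  * qhyper [:: q ^- n; z / a; (a * z)^-1] [:: (a * b)^-1] q (q ^+ n * a / b).

(* Q_n(x; a, b | q^-1) as a function of x: the formula is evaluated at one root
   z of z^2 - 2 x z + 1 = 0.  The other root is z^-1, and the choice does not
   matter, see [ascE]. *)
Definition asc (R : realType) (n : nat) (x a b q : R[i]) : R[i] :=
  asc_form n (x + sqrtC (x ^+ 2 - 1)) a b q.

Lemma asc_formV (R : realType) (n : nat) (z a b q : R[i]) :
  asc_form n z^-1 a b q = asc_form n z a b q.
Proof.
rewrite /asc_form /qhyper.
suff -> : qhyper_term [:: q ^- n; z^-1 / a; (a * z^-1)^-1] [:: (a * b)^-1] q
    = qhyper_term [:: q ^- n; z / a; (a * z)^-1] [:: (a * b)^-1] q by [].
apply/funext => w; apply/funext => k.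
rewrite /qhyper_term; congr (_ / _ * _ * _).
rewrite /qpochs !big_cons !big_nil !invfM invrK !mulr1.
by congr (_ * _); rewrite mulrC [a^-1 * _]mulrC [z^-1 / a]mulrC.
Qed.

Lemma askey_root (F : numClosedFieldType) (z : F) : z != 0 ->
  let x := (z + z^-1) / 2 in
  x + sqrtC (x ^+ 2 - 1) = z \/ x + sqrtC (x ^+ 2 - 1) = z^-1.
Proof.
move=> z0 x; set r := sqrtC _.
have xE : z + z^-1 = x * 2 by rewrite mulfVK// pnatr_eq0.
have rE : r ^+ 2 - (x ^+ 2 - 1) = 0 by rewrite sqrtCK subrr.
have zV : z * z^-1 = 1 by rewrite mulfV.
have : (x + r - z) * (x + r - z^-1) = 0.
  have -> : (x + r - z) * (x + r - z^-1)
      = (x + r) ^+ 2 - (x + r) * (z + z^-1) + z * z^-1.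
    by move: z^-1 => y; ring.
  by rewrite xE zV -[RHS]rE; ring.
by move/eqP; rewrite mulf_eq0 !subr_eq0 => /orP[] /eqP->; [left|right].
Qed.

Lemma ascE (R : realType) (n : nat) (z a b q : R[i]) : z != 0 ->
  asc n ((z + z^-1) / 2) a b q = asc_form n z a b q.
Proof.
move=> z0; rewrite /asc.
by have [->|->] := askey_root z0; rewrite ?asc_formV.
Qed.

(* Main.v *)
Require Import Defs.
From mathcomp Require Import all_boot all_order all_algebra.
From mathcomp Require Import zify ring lra.
From mathcomp Require Import complex.
From mathcomp Require Import all_classical all_reals all_analysis.
Import Order.TTheory GRing.Theory Num.Theory.
Import numFieldNormedType.Exports.
Import Normc.

(** Write [c = 1/(ab)], [s = - a t] and [w = - b t].  Since
    [(q^-n; q)_k = (q; q)_n / (q; q)_(n-k) (-1)^k q^(C(k,2) - n k)], the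
    powers of q in the terminating 3phi1 series cancel, and the n-th term of
    the left-hand side becomes
<<
  (gamma; q)_n sum_(k <= n) alpha_k s^k . w^(n-k) / (q; q)_(n-k),
  alpha_k = (z/a, 1/(az); q)_k / (q, c; q)_k
>>
    (lemma [asc_form_sum]).  Split [(gamma; q)_(k+m)] as
    [(gamma; q)_k (gamma q^k; q)_m] and sum over m = n - k first: the
    q-binomial theorem gives
<<
  sum_m (gamma q^k; q)_m / (q; q)_m w^m
    = (gamma w q^k; q)_oo / (w; q)_oo
    = (gamma w; q)_oo / (w; q)_oo / (gamma w; q)_k ,
>>
    and what remains is the sum over k of
    [alpha_k (gamma; q)_k / (gamma w; q)_k s^k], the 3phi2 series
    (lemma [qpoch_convolution_sum]).

    The exchange of the two summations is a dominated convergence argument.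
    All q-shifted factorials that occur, and the inverses of those in the
    denominators, are bounded uniformly in n, because [1 - a q^j] and its
    inverse, when it never vanishes, are [1 + O(|q|^j)] (lemmas
    [qpoch_bounded], [qpochV_bounded]).
    Hence every infinite series met here is dominated by a geometric one, and
    a single theorem on limits of geometrically dominated series
    ([cvg_limn_series_dom]) justifies the exchange.  It also serves in the
    proof of the q-binomial theorem, where the sum h(w) satisfies
    [(1 - w) h(w) = (1 - g w) h(q w)]; iterating and letting [w q^n] tend to
    0 yields the product formula. *)

Set Implicit Arguments.
Unset Strict Implicit.
Unset Printing Implicit Defensive.

Local Open Scope classical_set_scope.
Local Open Scope ring_scope.

(** * Norms and limits of complex sequences *)

(** The norm of the numeric field [R[i]] takes its values in [R[i]]; estimates
    are carried out with [normc], whose values lie in the ordered field [R]. *)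
Lemma normr_normc (R : realType) (x : R[i]) : `|x| = (normc x)%:C%C.
Proof. by []. Qed.

Lemma normc_ge0 (R : realType) (x : R[i]) : 0 <= normc x.
Proof. by rewrite -lecR; exact: (normr_ge0 x). Qed.

Lemma ler_normcD (R : realType) (x y : R[i]) :
  normc (x + y) <= normc x + normc y.
Proof. exact: le_normcD. Qed.

Lemma normcX (R : realType) (x : R[i]) n : normc (x ^+ n) = normc x ^+ n.
Proof.
by elim: n => [|n IH]; rewrite ?expr0 ?normc1// !exprS normcM IH.
Qed.

Lemma ler_normcB (R : realType) (x y z : R[i]) :
  normc (x - y) <= normc (x - z) + normc (z - y).
Proof. by have := ler_normcD (x - z) (z - y); rewrite addrA subrK. Qed.

Lemma normc_distC (R : realType) (x y : R[i]) : normc (x - y) = normc (y - x).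
Proof. by apply: (@complexI R); rewrite -!normr_normc distrC. Qed.

(** Every positive complex number is real, so a real [e] is enough. *)
Lemma cvgn_normcP (R : realType) (u : nat -> R[i]^o) (l : R[i]^o) :
  u @ \oo --> l <->
  forall e : R, 0 < e -> \forall n \near \oo, normc (l - u n) <= e.
Proof.
split=> [/cvgrPdist_le h e e0 | h].
  have e0' : 0 < e%:C%C by rewrite ltcR.
  by apply: filterS (h _ e0') => n; rewrite normr_normc lecR.
apply/cvgrPdist_le => e e0.
have eE : (complex.Re e)%:C%C = e by rewrite RRe_real// gtr0_real.
have e0' : 0 < complex.Re e by rewrite -ltcR eE.
by apply: filterS (h _ e0') => n; rewrite -lecR eE.
Qed.

Lemma cvgn_limE (R : realType) (u : nat -> R[i]^o) (l : R[i]^o) :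
  u @ \oo --> l -> limn u = l.
Proof. exact: cvg_lim. Qed.

Lemma cvgn_normc (R : realType) (u : nat -> R[i]^o) (l : R[i]^o) :
  u @ \oo --> l -> (fun n => normc (u n)) @ \oo --> normc l.
Proof.
move=> /cvgn_normcP ul; apply/cvgrPdist_le => e /ul; apply: filterS => n.
apply: le_trans; rewrite ler_norml; apply/andP; split.
  have := ler_normcD (u n - l) l; rewrite subrK normc_distC; lra.
by have := ler_normcD (l - u n) (u n); rewrite subrK; lra.
Qed.

Lemma normc_lim_le (R : realType) (u : nat -> R[i]^o) (l : R[i]^o) (M : R) :
  u @ \oo --> l -> (\forall n \near \oo, normc (u n) <= M) -> normc l <= M.
Proof.
move=> /cvgn_normc ul uM; rewrite -(cvg_lim _ ul)//.
by apply: limr_le => //; apply/cvg_ex; exists (normc l).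
Qed.

Lemma cvgn_normc_bounded (R : realType) (u : nat -> R[i]^o) :
  cvgn u -> exists M : R, forall n, normc (u n) <= M.
Proof.
move=> /cvg_ex[l /cvgn_normc ul].
have /cvg_seq_bounded[M [_ MP]] : cvgn (fun n => normc (u n)).
  by apply/cvg_ex; exists (normc l).
exists (M + 1) => n; apply: le_trans (MP (M + 1) _ n I); first exact: ler_norm.
by rewrite ltrDl.
Qed.

(** * Series dominated by a geometric series *)

(** Multiplying by [1 - r] telescopes the geometric bound, so that the
    induction on [p] needs no division. *)
Lemma normc_series_le (R : realType) (u : nat -> R[i]) (D r : R) m p :
  0 <= r < 1 -> (forall k, normc (u k) <= D * r ^+ k) ->
  (1 - r) * normc (series u (m + p)%N - series u m)
    <= D * (r ^+ m - r ^+ (m + p)).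
Proof.
move=> /andP[r0 r1] uD; elim: p => [|p IH].
  by rewrite addn0 !subrr normc0 !mulr0.
have r10 : 0 <= 1 - r by rewrite subr_ge0 ltW.
have -> : series u (m + p.+1)%N - series u m
          = series u (m + p)%N - series u m + u (m + p)%N.
  by rewrite addnS -(seriesSB u (m + p)); ring.
apply: le_trans (ler_wpM2l r10 (ler_normcD _ _)) _.
rewrite mulrDr; apply: le_trans (lerD IH (ler_wpM2l r10 (uD _))) _.
by rewrite addnS exprS le_eqVlt; apply/orP; left; apply/eqP; ring.
Qed.

Lemma cvg_series_real_dom (R : realType) (u : nat -> R) (D r : R) :
  0 <= r < 1 -> (forall k, `|u k| <= D * r ^+ k) -> cvgn (series u).
Proof.
move=> /andP[r0 r1] uD; apply: normed_cvg.
apply: (@series_le_cvg _ _ (geometric D r)) => //.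
- by move=> n; exact: normr_ge0.
- by move=> n; exact: le_trans (normr_ge0 _) (uD n).
- by apply: is_cvg_geometric_series; rewrite ger0_norm.
Qed.

Lemma normc_Re (R : realType) (x : R[i]) : `|complex.Re x| <= normc x.
Proof. by rewrite -lecR normc_ge_Re. Qed.

Lemma normc_Im (R : realType) (x : R[i]) : `|complex.Im x| <= normc x.
Proof.
case: x => x y /=; rewrite -sqrtr_sqr ler_wsqrtr// lerDr; exact: sqr_ge0.
Qed.

Lemma normc_ReIm (R : realType) (x : R[i]) :
  normc x <= `|complex.Re x| + `|complex.Im x|.
Proof.
rewrite -lecR -normr_normc {1}[x]complexE; apply: le_trans (ler_normD _ _) _.
by rewrite normrM normCi mul1r !normc_def/= !expr0n/= !addr0 !sqrtr_sqr rmorphD.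
Qed.

Lemma series_ReE (R : realType) (u : nat -> R[i]) n :
  complex.Re (series u n) = series (fun k => complex.Re (u k)) n.
Proof.
rewrite !seriesEnat/=; elim: n => [|n IH]; first by rewrite !big_nil.
by rewrite !big_nat_recr//= -IH; case: (\sum_(_ <= _ < _) _) (u n) => ? ? [].
Qed.

Lemma series_ImE (R : realType) (u : nat -> R[i]) n :
  complex.Im (series u n) = series (fun k => complex.Im (u k)) n.
Proof.
rewrite !seriesEnat/=; elim: n => [|n IH]; first by rewrite !big_nil.
by rewrite !big_nat_recr//= -IH; case: (\sum_(_ <= _ < _) _) (u n) => ? ? [].
Qed.

(** Completeness enters here, through the real and imaginary parts. *)
Lemma cvg_series_dom (R : realType) (u : nat -> R[i]) (D r : R) :
  0 <= r < 1 -> (forall k, normc (u k) <= D * r ^+ k) ->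
  cvgn (series (u : nat -> R[i]^o)).
Proof.
move=> r01 uD.
have /cvg_ex[x /cvgrPdist_le hx] : cvgn (series (fun k => complex.Re (u k))).
  apply: (cvg_series_real_dom (D := D) r01) => k.
  exact: le_trans (normc_Re _) (uD k).
have /cvg_ex[y /cvgrPdist_le hy] : cvgn (series (fun k => complex.Im (u k))).
  apply: (cvg_series_real_dom (D := D) r01) => k.
  exact: le_trans (normc_Im _) (uD k).
apply/cvg_ex; exists (x +i* y)%C; apply/cvgn_normcP => e e0.
have e2 : 0 < e / 2 by rewrite divr_gt0.
apply: filterS2 (hx _ e2) (hy _ e2) => n; rewrite -series_ReE -series_ImE.
move=> h1 h2; apply: le_trans (normc_ReIm _) _.
by move: h1 h2; case: (series u n) => s s' /=; lra.
Qed.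

Lemma normc_series_tail (R : realType) (u : nat -> R[i]) (D r : R) m :
  0 <= r < 1 -> (forall k, normc (u k) <= D * r ^+ k) ->
  normc (limn (series (u : nat -> R[i]^o)) - series u m)
    <= D / (1 - r) * r ^+ m.
Proof.
move=> r01 uD; have D0 : 0 <= D.
  by have := le_trans (normc_ge0 _) (uD 0%N); rewrite expr0 mulr1.
have r10 : 0 < 1 - r by case/andP: r01 => _; rewrite subr_gt0.
apply: (@normc_lim_le _ (fun n => series u n - series u m)).
  by apply: cvgB; [exact: cvg_series_dom uD | exact: cvg_cst].
exists m => // n /= /subnKC <-.
rewrite mulrAC ler_pdivlMr// mulrC.
apply: le_trans (normc_series_le _ _ r01 uD) _.
rewrite ler_wpM2l// lerBlDr lerDl exprn_ge0//; by case/andP: r01.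
Qed.

(** Tannery's theorem for a geometric majorant: beyond an index m chosen from
    the majorant, the tails of all the series [F n] and of [L] are small at
    once, and below m only a finite sum has to converge. *)
Lemma cvg_limn_series_dom (R : realType) (F : nat -> nat -> R[i])
    (L : nat -> R[i]) (D r : R) :
  0 <= r < 1 -> (forall n k, normc (F n k) <= D * r ^+ k) ->
  (forall k, (fun n => F n k : R[i]^o) @ \oo --> (L k : R[i]^o)) ->
  (fun n => limn (series (F n : nat -> R[i]^o))) @ \oo
    --> limn (series (L : nat -> R[i]^o)).
Proof.
move=> r01 FD FL.
have LD k : normc (L k) <= D * r ^+ k.
  by apply: normc_lim_le (FL k) _; apply: nearW.
have /cvgrPdist_le geo : geometric (D / (1 - r)) r @ \oo --> (0 : R).
  by apply: cvg_geometric; case/andP: r01 => r0 r1; rewrite ger0_norm.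
apply/cvgn_normcP => e e0; have e3 : 0 < e / 3 by rewrite divr_gt0.
have [m _ /(_ m (leqnn _))] := geo _ e3.
rewrite /= sub0r normrN => /(le_trans (ler_norm _)) hm.
have Fm : (fun n => series (F n : nat -> R[i]^o) m) @ \oo
    --> (series (L : nat -> R[i]^o) m).
  rewrite seriesEnat /=; under eq_fun do rewrite seriesEnat /=.
  by apply: cvg_big => //; exact: add_continuous.
move/cvgn_normcP: Fm => /(_ _ e3); apply: filterS => n hn.
have h1 := normc_series_tail m r01 LD.
have h2 := normc_series_tail m r01 (FD n).
rewrite normc_distC in h2.
apply: le_trans (ler_normcB _ _ (series L m)) _.
have := ler_normcB (series L m) (limn (series (F n : nat -> R[i]^o)))
  (series (F n) m).
lra.
Qed.
(** * Finite and infinite q-shifted factorials *)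

Lemma qpoch0 (F : fieldType) (a q : F) : qpoch a q 0 = 1.
Proof. by rewrite /qpoch big_ord0. Qed.

Lemma qpochS (F : fieldType) (a q : F) n :
  qpoch a q n.+1 = qpoch a q n * (1 - a * q ^+ n).
Proof. by rewrite /qpoch big_ord_recr. Qed.

Lemma qpochD (F : fieldType) (a q : F) m n :
  qpoch a q (m + n)%N = qpoch a q m * qpoch (a * q ^+ m) q n.
Proof.
elim: n => [|n IH]; first by rewrite addn0 qpoch0 mulr1.
by rewrite addnS !qpochS IH exprD !mulrA.
Qed.

Lemma qpoch_neq0 (F : fieldType) (a q : F) n :
  (forall k, 1 - a * q ^+ k != 0) -> qpoch a q n != 0.
Proof. by move=> aq; apply/prodf_neq0 => k _. Qed.

(** From [1 + x <= exp x] and the sum of the geometric series. *)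
Lemma prod1D_bounded (R : realType) (c : nat -> R[i]) (D r : R) n :
  0 <= r < 1 -> (forall k, normc (c k) <= D * r ^+ k) ->
  normc (\prod_(k < n) (1 + c k)) <= expR (D / (1 - r)).
Proof.
move=> /andP[r0 r1] cD; have D0 : 0 <= D.
  by have := le_trans (normc_ge0 _) (cD 0%N); rewrite expr0 mulr1.
apply: (@le_trans _ _ (expR (\sum_(k < n) D * r ^+ k))).
  elim: n => [|n IH]; first by rewrite !big_ord0 expR0 normc1.
  rewrite !big_ord_recr/= expRD normcM ler_pM ?normc_ge0//.
  apply: le_trans (expR_ge1Dx _); apply: le_trans (ler_normcD _ _) _.
  by rewrite normc1 lerD2l.
rewrite ler_expR -mulr_sumr ler_wpM2l// -[leRHS]mul1r ler_pdivlMr ?subr_gt0//.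
rewrite mulrC; have := subrX1 r n.
have := exprn_ge0 n r0; lra.
Qed.

Lemma normc01 (R : realType) (q : R[i]) : `|q| < 1 -> 0 <= normc q < 1.
Proof. by rewrite normr_normc ltcR normc_ge0. Qed.

Lemma cvg_expr0 (R : realType) (a q : R[i]) : `|q| < 1 ->
  (fun n => a * q ^+ n : R[i]^o) @ \oo --> (0 : R[i]^o).
Proof.
move=> /normc01/andP[q0 q1]; apply/cvgn_normcP => e e0.
have /cvgrPdist_le/(_ _ e0) :
    geometric (normc a) (normc q) @ \oo --> (0 : R).
  by apply: cvg_geometric; rewrite ger0_norm.
apply: filterS => n /=; rewrite !sub0r normrN => /(le_trans (ler_norm _)).
by rewrite normcN normcM normcX.
Qed.

Section QPochhammer.
Variables (R : realType) (q : R[i]).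
Hypothesis q_lt1 : `|q| < 1.

Lemma qpoch_bounded (a : R[i]) :
  exists M : R, forall n, normc (qpoch a q n) <= M.
Proof.
exists (expR (normc a / (1 - normc q))) => n; rewrite /qpoch.
apply: (@prod1D_bounded _ (fun k => - (a * q ^+ k))); first exact: normc01.
by move=> k; rewrite normcN normcM normcX.
Qed.

(** [(1 - x)^-1 = 1 + x (1 - x)^-1] with [x = a q^k], and the factor
    [(1 - x)^-1] is bounded because it converges to 1; so
    [prod1D_bounded] applies to the inverse product too. *)
Lemma qpochV_bounded (a : R[i]) : (forall k, 1 - a * q ^+ k != 0) ->
  exists M : R, forall n, normc (qpoch a q n)^-1 <= M.
Proof.
move=> aq.
have [K KP] : exists K : R, forall k, normc (1 - a * q ^+ k)^-1 <= K.
  apply: (@cvgn_normc_bounded _ (fun k => (1 - a * q ^+ k)^-1)).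
  apply/cvg_ex; exists (1 - 0)^-1; apply: (@cvgV R[i]).
    by rewrite subr0 oner_eq0.
  by apply: cvgB; [exact: cvg_cst | exact: cvg_expr0].
exists (expR (normc a * K / (1 - normc q))) => n.
rewrite /qpoch -prodfV.
rewrite (eq_bigr (fun k : 'I_n =>
  1 + a * q ^+ k * (1 - a * q ^+ k)^-1)); last first.
  move=> k _; have := aq k; move: (a * q ^+ k) => x x1.
  by field.
apply: (@prod1D_bounded _ (fun k => a * q ^+ k * (1 - a * q ^+ k)^-1)).
  exact: normc01.
move=> k; rewrite !normcM normcX -!mulrA ler_wpM2l ?normc_ge0//.
by rewrite mulrC ler_wpM2r// exprn_ge0// normc_ge0.
Qed.

(** The increments [- a q^k (a; q)_k] of the partial products are dominated
    by a geometric sequence. *)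
Lemma qpoch_cvg (a : R[i]) :
  (qpoch a q : nat -> R[i]^o) @ \oo --> (qpoch_inf a q : R[i]^o).
Proof.
have [M MP] := qpoch_bounded a.
have : cvgn (series (fun k => - (a * q ^+ k) * qpoch a q k : R[i]^o)).
  apply: (@cvg_series_dom _ _ (normc a * M) _ (normc01 q_lt1)) => k.
  rewrite normcM normcN normcM normcX mulrAC.
  rewrite ler_wpM2r ?exprn_ge0 ?normc_ge0//.
  by rewrite ler_wpM2l ?normc_ge0.
move=> /cvg_ex[l hl]; suff : cvgn (qpoch a q : nat -> R[i]^o) by [].
apply/cvg_ex; exists (1 + l).
have -> : (qpoch a q : nat -> R[i]^o)
    = (fun n => 1 + series (fun k => - (a * q ^+ k) * qpoch a q k : R[i]^o) n).
  apply/funext => n; rewrite seriesEnat/=.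
  elim: n => [|n IH]; first by rewrite big_nil qpoch0 addr0.
  by rewrite big_nat_recr//= addrA -IH qpochS; ring.
by apply: cvgD; [exact: cvg_cst | exact: hl].
Qed.

(** A limit 0 would contradict the bound on the inverses. *)
Lemma qpoch_inf_neq0 (a : R[i]) :
  (forall k, 1 - a * q ^+ k != 0) -> qpoch_inf a q != 0.
Proof.
move=> aq; have [M MP] := qpochV_bounded aq.
apply/eqP => a0; have := @qpoch_cvg a; rewrite a0 => /cvgn_normc.
have M0 : 0 < M.
  apply: lt_le_trans (MP 0%N); rewrite qpoch0 invr1 normc1; exact: ltr01.
have M2 : 0 < M^-1 / 2 by rewrite divr_gt0 ?invr_gt0.
move=> /cvgrPdist_le/(_ _ M2)[n _ /(_ n (leqnn n))].
rewrite normc0 sub0r normrN ger0_norm ?normc_ge0//.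
have : M^-1 <= normc (qpoch a q n).
  rewrite -[X in _ <= X]invrK lef_pV2 ?posrE ?invr_gt0//.
    by rewrite -normcV.
  rewrite lt_def normc_ge0 andbT; apply/eqP => /eq0_normc/eqP.
  exact/negP/qpoch_neq0.
have : 0 < M^-1 by rewrite invr_gt0.
lra.
Qed.

Lemma qpoch_infD (a : R[i]) m :
  qpoch_inf a q = qpoch a q m * qpoch_inf (a * q ^+ m) q.
Proof.
have h1 : (fun n => qpoch a q (n + m)%N : R[i]^o) @ \oo
    --> (qpoch_inf a q : R[i]^o).
  by rewrite (cvg_shiftn m (qpoch a q : nat -> R[i]^o)); exact: qpoch_cvg.
rewrite -(cvgn_limE h1); apply: cvgn_limE.
under eq_fun do rewrite addnC qpochD.
by apply: cvgM; [exact: cvg_cst | exact: qpoch_cvg].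
Qed.

Lemma one_sub_expr_neq0 (w : R[i]) k : `|w| < 1 -> 1 - w * q ^+ k != 0.
Proof.
move=> w1; rewrite subr_eq0; apply/eqP => /(congr1 (fun x : R[i] => `|x|)).
apply/eqP; rewrite normr1 normrM normrX gt_eqF//.
by apply: le_lt_trans w1; rewrite ler_piMr// exprn_ile1// ltW.
Qed.

End QPochhammer.
(** * The q-binomial theorem *)

Lemma limn_series_finite (R : realType) (u : nat -> R[i]) n :
  (forall k, (n <= k)%N -> u k = 0) ->
  limn (series (u : nat -> R[i]^o)) = series u n.
Proof.
move=> u0; apply: cvgn_limE; apply: cvg_near_cst; exists n => // m /= nm.
apply/eqP; rewrite -subr_eq0 sub_series_geq//; apply/eqP.
by rewrite big_nat_cond big1// => k /andP[/andP[/u0]].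
Qed.

Lemma cvg_series_term0 (R : realType) (u : nat -> R[i]) :
  cvgn (series (u : nat -> R[i]^o)) ->
  (u : nat -> R[i]^o) @ \oo --> (0 : R[i]^o).
Proof. exact: (@cvg_series_cvg_0 _ R[i]^o). Qed.

Section QBinomial.
Variables (R : realType) (q : R[i]).
Hypothesis q_lt1 : `|q| < 1.

Lemma one_sub_qexpr_neq0 k : 1 - q * q ^+ k != 0.
Proof. exact: one_sub_expr_neq0. Qed.

Variable g : R[i].

Let c m := qpoch g q m / qpoch q q m.

Lemma qbinomial_coef_bounded :
  exists M : R, forall m, normc (qpoch g q m / qpoch q q m) <= M.
Proof.
have [M MP] := qpoch_bounded q_lt1 g.
have [K KP] := qpochV_bounded q_lt1 one_sub_qexpr_neq0.
by exists (M * K) => m; rewrite normcM ler_pM ?normc_ge0.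
Qed.

Lemma qbinomial_coefS m : c m.+1 * (1 - q * q ^+ m) = c m * (1 - g * q ^+ m).
Proof.
rewrite /c !qpochS; have := one_sub_qexpr_neq0 m.
have := qpoch_neq0 m one_sub_qexpr_neq0.
move: (qpoch q q m) (1 - q * q ^+ m) => x y x0 y0.
by field; rewrite x0 y0.
Qed.

Let h (v : R[i]) := limn (series (fun m => c m * v ^+ m : R[i]^o)).

Lemma qbinomial_cvg (v : R[i]) : `|v| < 1 ->
  cvgn (series (fun m => qpoch g q m / qpoch q q m * v ^+ m : R[i]^o)).
Proof.
move=> v1; have [M MP] := qbinomial_coef_bounded.
apply: (@cvg_series_dom _ _ M _ (normc01 v1)) => m.
by rewrite normcM normcX ler_wpM2r ?exprn_ge0 ?normc_ge0.
Qed.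

(** By the recurrence [qbinomial_coefS] the coefficients cancel in the
    functional equation, and truncation leaves a single boundary term. *)
Lemma qbinomial_partial (w : R[i]) N :
  (1 - w) * series (fun m => c m * w ^+ m) N
    - (1 - g * w) * series (fun m => c m * (q * w) ^+ m) N
  = c N * (q * w) ^+ N - c N * w ^+ N.
Proof.
rewrite !seriesEnat/=; elim: N => [|N IH].
  by rewrite !big_nil !mulr0 !expr0 !subrr.
rewrite !big_nat_recr//= !mulrDr opprD addrACA IH.
have := qbinomial_coefS N; rewrite !exprMn !exprS.
move: (c N) (c N.+1) (q ^+ N) (w ^+ N) => x y s r e.
transitivity (- (y * (1 - q * s)) * (w * r)); last by ring.
by rewrite e; ring.
Qed.

Lemma qbinomial_functional (w : R[i]) : `|w| < 1 ->
  (1 - w) * h w = (1 - g * w) * h (q * w).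
Proof.
move=> w1; have qw1 : `|q * w| < 1.
  by rewrite normrM (le_lt_trans _ w1)// ler_piMl// ltW.
have lhs : (fun N => (1 - w) * series (fun m => c m * w ^+ m : R[i]^o) N
    - (1 - g * w) * series (fun m => c m * (q * w) ^+ m : R[i]^o) N : R[i]^o)
    @ \oo --> ((1 - w) * h w - (1 - g * w) * h (q * w) : R[i]^o).
  by apply: cvgB; apply: cvgM; (try exact: cvg_cst); exact: qbinomial_cvg.
have rhs : (fun N => c N * (q * w) ^+ N - c N * w ^+ N : R[i]^o)
    @ \oo --> (0 - 0 : R[i]^o).
  by apply: cvgB; apply: cvg_series_term0; exact: qbinomial_cvg.
move: lhs; under eq_fun do rewrite qbinomial_partial.
move=> /cvgn_limE; rewrite (cvgn_limE rhs) subrr => /esym/eqP.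
by rewrite subr_eq0 => /eqP.
Qed.

Lemma qbinomial_iter (w : R[i]) n : `|w| < 1 ->
  qpoch w q n * h w = qpoch (g * w) q n * h (w * q ^+ n).
Proof.
move=> w1; elim: n => [|n IH]; first by rewrite !qpoch0 expr0 mulr1.
have wn1 : `|w * q ^+ n| < 1.
  apply: le_lt_trans w1; rewrite normrM normrX ler_piMr ?exprn_ile1//.
  exact: ltW.
rewrite !qpochS mulrAC IH -!mulrA [h _ * _]mulrC (qbinomial_functional wn1).
by rewrite [q * (w * _)]mulrCA -exprS.
Qed.

(** Continuity of the sum at 0: all terms but the constant one vanish in the
    limit, under the majorant [M |w|^k] valid for every n. *)
Lemma qbinomial_at0 (w : R[i]) : `|w| < 1 ->
  (fun n => h (w * q ^+ n) : R[i]^o) @ \oo --> (1 : R[i]^o).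
Proof.
move=> w1; have [M MP] := qbinomial_coef_bounded.
have <- : limn (series (fun k => (k == 0%N)%:R : R[i]^o)) = 1.
  rewrite (@limn_series_finite _ _ 1); last by case.
  by rewrite seriesEnat/= big_nat1.
apply: (@cvg_limn_series_dom _ _ _ M _ (normc01 w1)) => [n k|k].
  have /andP[q0 q1] := normc01 q_lt1.
  rewrite normcM normcX; apply: ler_pM; rewrite ?exprn_ge0 ?normc_ge0//.
    exact: MP.
  rewrite lerXn2r ?nnegrE ?normc_ge0// normcM normcX.
  by rewrite ler_piMr ?normc_ge0// exprn_ile1// ltW.
case: k => [|k] /=.
  rewrite /c !qpoch0 divr1; under eq_fun do rewrite expr0 mulr1.
  exact: cvg_cst.
under eq_fun do rewrite exprMn -exprM mulnC exprM mulrA.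
by apply: cvg_expr0; rewrite normrX exprn_ilt1.
Qed.

Theorem qbinomial_theorem (w : R[i]) : `|w| < 1 ->
  limn (series (fun m => qpoch g q m / qpoch q q m * w ^+ m : R[i]^o))
  = qpoch_inf (g * w) q / qpoch_inf w q.
Proof.
move=> w1; have w0 : qpoch_inf w q != 0.
  by apply: qpoch_inf_neq0 => // k; exact: one_sub_expr_neq0.
apply: (mulIf w0); rewrite divfK// mulrC -/(h w).
have lhs : (fun n => qpoch w q n * h w : R[i]^o) @ \oo
    --> (qpoch_inf w q * h w : R[i]^o).
  by apply: cvgM; [exact: qpoch_cvg | exact: cvg_cst].
have rhs : (fun n => qpoch (g * w) q n * h (w * q ^+ n) : R[i]^o) @ \oo
    --> (qpoch_inf (g * w) q * 1 : R[i]^o).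
  by apply: cvgM; [exact: qpoch_cvg | exact: qbinomial_at0].
rewrite -(cvgn_limE lhs) -[RHS]mulr1 -(cvgn_limE rhs).
by under eq_fun do rewrite (qbinomial_iter _ w1).
Qed.

End QBinomial.
(** * Summation of the generating function *)

(** Both sides run over the pairs [(k, m)] with [k + m < N]. *)
Lemma sum_triangle (F : comPzRingType) (G f h : nat -> F) N :
  \sum_(n < N) G n * \sum_(k < n.+1) f k * h (n - k)%N
  = \sum_(k < N) f k * \sum_(m < N - k) G (k + m)%N * h m.
Proof.
elim: N => [|N IH]; first by rewrite !big_ord0.
rewrite big_ord_recr/= IH [RHS]big_ord_recr/= subSnn big_ord1 addn0.
rewrite [in LHS]big_ord_recr/= subnn mulrDr addrA [G N * (f N * _)]mulrCA.
congr (_ + _); rewrite mulr_sumr -big_split/=; apply: eq_bigr => k _.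
rewrite subSn; last exact/ltnW.
rewrite big_ord_recr/= subnKC; last exact/ltnW.
by rewrite mulrDr [f k * (_ * _)]mulrCA.
Qed.

Section Transformation.
Variables (R : realType) (q : R[i]).
Hypothesis q_lt1 : `|q| < 1.

(** The coefficients [al] are arbitrary bounded ones: the argument uses only
    the q-binomial theorem for the inner sum over m = n - k. *)
Lemma qpoch_convolution_sum (g s w : R[i]) (al : nat -> R[i]) (M : R) :
  `|s| < 1 -> `|w| < 1 -> (forall k, normc (al k) <= M) ->
  (forall k, 1 - g * w * q ^+ k != 0) ->
  let T k := al k * qpoch g q k / qpoch (g * w) q k * s ^+ k in
  cvgn (series (T : nat -> R[i]^o)) /\
  series (fun n => qpoch g q n *
    \sum_(k < n.+1) al k * s ^+ k * (w ^+ (n - k) / qpoch q q (n - k))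
      : R[i]^o) @ \oo -->
  (qpoch_inf (g * w) q / qpoch_inf w q * limn (series (T : nat -> R[i]^o))
     : R[i]^o).
Proof.
move=> s1 w1 alM gw T.
have [Mg MgP] := qpoch_bounded q_lt1 g.
have [Mw MwP] := qpochV_bounded q_lt1 gw.
have [Mq MqP] := qpochV_bounded q_lt1 (one_sub_qexpr_neq0 q_lt1).
have Tcvg : cvgn (series (T : nat -> R[i]^o)).
  apply: (@cvg_series_dom _ _ (M * Mg * Mw) _ (normc01 s1)) => k.
  rewrite /T [normc (_ * s ^+ k)]normcM normcX.
  rewrite ler_wpM2r ?exprn_ge0 ?normc_ge0//.
  by rewrite !normcM !ler_pM ?mulr_ge0 ?normc_ge0.
split; first exact: Tcvg.
(* [u k] is the inner series, of sum [ucvg]; its partial sums are bounded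
   uniformly in k, which gives the majorant for the outer one. *)
pose u k m := qpoch g q (k + m)%N * (w ^+ m / qpoch q q m).
have uD k m : normc (u k m) <= Mg * Mq * normc w ^+ m.
  rewrite /u !normcM normcX [_ ^+ m * _]mulrC mulrA.
  by rewrite ler_wpM2r ?exprn_ge0 ?normc_ge0// ler_pM ?normc_ge0.
have ucvg k : series (u k : nat -> R[i]^o) @ \oo
    --> (qpoch g q k * (qpoch_inf (g * w) q / qpoch (g * w) q k
         / qpoch_inf w q) : R[i]^o).
  have -> : qpoch_inf (g * w) q / qpoch (g * w) q k
      = qpoch_inf (g * q ^+ k * w) q.
    rewrite (qpoch_infD q_lt1 _ k) mulrC mulKf; last exact: qpoch_neq0.
    by rewrite mulrAC.
  rewrite -(qbinomial_theorem q_lt1 (g * q ^+ k) w1).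
  have -> : (series (u k) : nat -> R[i]^o)
      = (fun n => qpoch g q k * series (fun m =>
          qpoch (g * q ^+ k) q m / qpoch q q m * w ^+ m : R[i]^o) n).
    apply/funext => n; rewrite !seriesEnat/= mulr_sumr.
    apply: eq_bigr => m _; rewrite /u qpochD -!mulrA.
    by rewrite [w ^+ m * _]mulrC.
  by apply: cvgM; [exact: cvg_cst | exact: qbinomial_cvg].
(* For k >= n the truncated length n - k is 0, so [F n] is finitely supported
   and its sum is the n-th partial sum of the double series. *)
pose F n k := al k * s ^+ k * series (u k) (n - k)%N.
pose L k := qpoch_inf (g * w) q / qpoch_inf w q * T k.
have -> : series (fun n => qpoch g q n *
    \sum_(k < n.+1) al k * s ^+ k * (w ^+ (n - k) / qpoch q q (n - k)) : R[i]^o)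
    = (fun n => limn (series (F n : nat -> R[i]^o))).
  apply/funext => n; rewrite (@limn_series_finite _ _ n); last first.
    move=> k; rewrite -subn_eq0 => /eqP nk.
    by rewrite /F nk seriesEnat/= big_nil mulr0.
  rewrite !seriesEord/=.
  rewrite (@sum_triangle _ (qpoch g q) (fun k => al k * s ^+ k)
    (fun m => w ^+ m / qpoch q q m)).
  by apply: eq_bigr => k _; rewrite /F seriesEord.
have -> : qpoch_inf (g * w) q / qpoch_inf w q
      * limn (series (T : nat -> R[i]^o))
    = limn (series (L : nat -> R[i]^o)).
  apply/esym; apply: cvgn_limE.
  have -> : series (L : nat -> R[i]^o) = (fun n =>
      qpoch_inf (g * w) q / qpoch_inf w q * series (T : nat -> R[i]^o) n).
    by apply/funext => n; rewrite !seriesEnat/= mulr_sumr.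
  by apply: cvgM; [exact: cvg_cst | exact: Tcvg].
apply: (@cvg_limn_series_dom _ F L
    (M * (Mg * Mq / (1 - normc w))) _ (normc01 s1)) => [n k|k].
  rewrite /F normcM normcM normcX mulrAC.
  rewrite ler_wpM2r ?exprn_ge0 ?normc_ge0// ler_pM ?normc_ge0//.
  have /andP[w0 wlt1] := normc01 w1.
  have Mgq : 0 <= Mg * Mq.
    by have := le_trans (normc_ge0 _) (uD 0%N 0%N); rewrite expr0 mulr1.
  rewrite ler_pdivlMr ?subr_gt0// mulrC.
  have := @normc_series_le _ (u k) _ _ 0 (n - k) (normc01 w1) (uD k).
  rewrite add0n seriesEnat/= big_nil subr0 expr0 => /le_trans; apply.
  by rewrite ler_piMr// lerBlDr lerDl exprn_ge0.
have -> : L k = al k * s ^+ k * (qpoch g q k *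
    (qpoch_inf (g * w) q / qpoch (g * w) q k / qpoch_inf w q)).
  by rewrite /L /T; ring.
apply: cvgM; first exact: cvg_cst.
rewrite -(cvg_shiftn k); under eq_fun do rewrite addnK.
exact: ucvg.
Qed.

End Transformation.

(** * Expansion of the polynomials *)

(** The classical formula for [(q^-n; q)_k] with n = k + m, in a form free of
    [n - k]; the step uses [1 - q^-(m+1) = - q^-(m+1) (1 - q^(m+1))] and the
    case (k, m + 1). *)
Lemma qpoch_exprN (F : fieldType) (q : F) k m : q != 0 ->
  qpoch (q ^- (k + m)) q k * qpoch q q m
  = qpoch q q (k + m)%N * ((-1) ^+ k * q ^+ 'C(k, 2)) / q ^+ ((k + m) * k).
Proof.
move=> q0; elim: k m => [|k IH] m.
  by rewrite qpoch0 add0n muln0 bin0n !expr0 !mul1r !mulr1 divr1.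
have := IH m.+1; rewrite addnS -addSn => {}IH.
have -> : qpoch (q ^- (k.+1 + m)) q k.+1 * qpoch q q m
   = - (qpoch (q ^- (k.+1 + m)) q k * qpoch q q m.+1) / q ^+ m.+1.
  rewrite !qpochS -exprS.
  have -> : q ^+ (k.+1 + m) = q ^+ k * q ^+ m.+1.
    by rewrite addSnnS exprD.
  have step (x y u v : F) : u != 0 -> v != 0 ->
      x * (1 - (u * v)^-1 * u) * y = - (x * (y * (1 - v))) / v.
    by move=> u0 v0; field; rewrite u0 v0.
  by apply: step; exact: expf_neq0.
rewrite IH binS bin1 exprD [(-1) ^+ k.+1]exprS.
have -> : q ^+ ((k.+1 + m) * k.+1) = q ^+ ((k.+1 + m) * k) * q ^+ k * q ^+ m.+1.
  by rewrite mulnS -!exprD; congr (_ ^+ _); lia.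
have step (x s d u v w : F) : u != 0 -> v != 0 -> w != 0 ->
    - (x * (s * d) / w) / v = x * (- 1 * s * (d * u)) / (w * u * v).
  by move=> u0 v0 w0; field; rewrite u0 v0 w0.
by apply: step; exact: expf_neq0.
Qed.

Lemma qpoch_exprN_eq0 (F : fieldType) (q : F) n k : q != 0 -> (n < k)%N ->
  qpoch (q ^- n) q k = 0.
Proof.
move=> q0 nk; rewrite /qpoch (bigD1 (Ordinal nk))//=.
by rewrite mulVf ?expf_neq0// subrr mul0r.
Qed.

(** The 3phi1 series stops at k = n, and its exponent 1 + 1 - 3 = -1 removes
    the factor [(-1)^k q^C(k,2)] produced by [(q^-n; q)_k]. *)
Lemma asc_form_sum (R : realType) (n : nat) (z a b q t : R[i]) :
  0 < `|q| -> `|q| < 1 -> b != 0 ->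
  (forall k : nat, 1 - (a * b)^-1 * q ^+ k != 0) ->
  t ^+ n * q ^+ 'C(n, 2) * asc_form n z a b q / qpochs [:: q; (a * b)^-1] q n
  = \sum_(k < n.+1) (qpoch (z / a) q k * qpoch (a * z)^-1 q k
        / qpoch q q k / qpoch (a * b)^-1 q k) * (- (a * t)) ^+ k
      * ((- (b * t)) ^+ (n - k) / qpoch q q (n - k)).
Proof.
move=> q_gt0 q_lt1 b0 c0; have q0 : q != 0 by rewrite -normr_gt0.
rewrite /asc_form /qhyper (@limn_series_finite _ _ n.+1); last first.
  move=> k nk; rewrite /qhyper_term {1}/qpochs big_cons qpoch_exprN_eq0//.
  by rewrite !mul0r.
have qq := one_sub_qexpr_neq0 q_lt1.
rewrite seriesEord/= !mulr_sumr mulr_suml; apply: eq_bigr => k _.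
have := ltn_ord k; rewrite ltnS; move: (nat_of_ord k) => {}k kn.
have nE := subnKC kn; move: (n - k)%N nE => m /esym nE.
rewrite /qhyper_term /qpochs !big_cons !big_nil !mulr1.
(* The integer exponent 1 + 1 - 3 computes to -1. *)
rewrite [(_ ^ _)](_ : _ = ((-1) ^+ k * q ^+ 'C(k, 2))^-1)//.
have h1 := qpoch_neq0 n c0; have h2 := qpoch_neq0 n qq.
have h3 := qpoch_neq0 k c0; have h4 := qpoch_neq0 k qq.
have h5 := qpoch_neq0 m qq.
have -> : qpoch (q ^- n) q k = qpoch q q n * ((-1) ^+ k * q ^+ 'C(k, 2))
    / q ^+ (n * k) / qpoch q q m.
  by rewrite nE -qpoch_exprN// mulfK.
have d0 : (-1) ^+ k * q ^+ 'C(k, 2) != 0.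
  by rewrite mulf_neq0 ?expf_neq0// oppr_eq0 oner_eq0.
have e0 := expf_neq0 (n * k) q0; have f0 := expf_neq0 'C(n, 2) q0.
have bk := expf_neq0 k b0.
have tbE : t ^+ n * (- b) ^+ n
    = (- (b * t)) ^+ m * ((-1) ^+ k * b ^+ k) * t ^+ k.
  rewrite -exprMn mulrN [t * b]mulrC nE addnC exprD -[RHS]mulrA.
  by congr (_ * _); rewrite [LHS]exprNn exprMn mulrA.
have -> : (q ^+ n * a / b) ^+ k = q ^+ (n * k) * a ^+ k / b ^+ k.
  by rewrite !exprMn exprVn -exprM.
rewrite [(- (a * t)) ^+ k]exprNn [(a * t) ^+ k]exprMn.
have simplify (T f bn cn P d e p A B qk ck ak bk' s tk W : R[i]) :
    f != 0 -> cn != 0 -> P != 0 -> d != 0 -> e != 0 -> p != 0 -> qk != 0 ->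
    ck != 0 -> bk' != 0 -> T * bn = W * (s * bk') * tk ->
    T * f * (f^-1 * bn * cn * (P * d / e / p * (A * B) / (qk * ck) * d^-1
      * (e * ak / bk'))) / (P * cn)
    = A * B / qk / ck * (s * (ak * tk)) * (W / p).
  move=> ? ? ? ? ? ? ? ? bk0 TE.
  transitivity (T * bn * (A * B / qk / ck * ak / bk' / p)).
    by field; do ?[apply/andP; split].
  by rewrite TE; field; do ?[apply/andP; split].
exact: simplify.
Qed.

Theorem theorem6p23 (R : realType) (q z x gamma a b t : R[i])
    (q_gt0 : 0 < `|q|) (q_lt1 : `|q| < 1)
    (z_neq0 : z != 0) (x_def : x = (z + z^-1) / 2) (x_neq0 : x != 0)
    (gamma_neq0 : gamma != 0) (a_neq0 : a != 0) (b_neq0 : b != 0)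
    (t_neq0 : t != 0)
    (at_lt1 : `|a * t| < 1) (bt_lt1 : `|b * t| < 1)
    (ab_notin : forall k : nat, (a * b)^-1 != q ^- k)
    (gbt_notin : forall k : nat, - (gamma * b * t) != q ^- k) :
  qhyper_cvg [:: gamma; z / a; (a * z)^-1]
             [:: (a * b)^-1; - (gamma * b * t)] q (- (a * t))
  /\
  series ((fun n : nat =>
      t ^+ n * qpoch gamma q n * q ^+ 'C(n, 2) * asc n x a b q
      / qpochs [:: q; (a * b)^-1] q n) : nat -> R[i]^o) @ \oo -->
    ((qpoch_inf (- (gamma * b * t)) q / qpoch_inf (- (b * t)) q
     * qhyper [:: gamma; z / a; (a * z)^-1]
              [:: (a * b)^-1; - (gamma * b * t)] q (- (a * t))) : R[i]^o).
Proof.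
have q0 : q != 0 by rewrite -normr_gt0.
have one_sub (c : R[i]) : (forall k, c != q ^- k) ->
    forall k, 1 - c * q ^+ k != 0.
  move=> cq k; apply: contra (cq k); rewrite subr_eq0 => /eqP c1.
  by apply/eqP; rewrite -[LHS](mulfK (expf_neq0 k q0)) -c1 mul1r.
have c0 := one_sub _ ab_notin; have gbt0 := one_sub _ gbt_notin.
have gE : - (gamma * b * t) = gamma * - (b * t) by rewrite mulrN mulrA.
rewrite gE in gbt0 *.
pose al k := qpoch (z / a) q k * qpoch (a * z)^-1 q k
  / qpoch q q k / qpoch (a * b)^-1 q k.
have [M alM] : exists M : R, forall k, normc (al k) <= M.
  have [M1 h1] := qpoch_bounded q_lt1 (z / a).
  have [M2 h2] := qpoch_bounded q_lt1 (a * z)^-1.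
  have [M3 h3] := qpochV_bounded q_lt1 (one_sub_qexpr_neq0 q_lt1).
  have [M4 h4] := qpochV_bounded q_lt1 c0.
  exists (M1 * M2 * M3 * M4) => k.
  by rewrite !normcM !ler_pM ?mulr_ge0 ?normc_ge0.
have at1 : `|- (a * t)| < 1 by rewrite normrN.
have bt1 : `|- (b * t)| < 1 by rewrite normrN.
have [T_cvg sum_cvg] := qpoch_convolution_sum q_lt1 at1 bt1 alM gbt0.
have TE : qhyper_term [:: gamma; z / a; (a * z)^-1]
      [:: (a * b)^-1; gamma * - (b * t)] q (- (a * t))
    = (fun k => al k * qpoch gamma q k / qpoch (gamma * - (b * t)) q k
        * (- (a * t)) ^+ k).
  (* For the 3phi2 series the exponent 1 + 2 - 3 is 0. *)
  apply/funext => k; rewrite /qhyper_term [(_ ^ _)](_ : _ = 1)// mulr1.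
  rewrite /qpochs !big_cons !big_nil !mulr1 /al !invfM; congr (_ * _).
  by move: (_^-1) (_^-1) (_^-1) => u v w; ring.
rewrite /qhyper_cvg /qhyper TE; split; first exact: T_cvg.
set S := (X in series X @ _ --> _).
have -> : S = (fun n => qpoch gamma q n * \sum_(k < n.+1) al k
    * (- (a * t)) ^+ k * ((- (b * t)) ^+ (n - k) / qpoch q q (n - k))).
  apply/funext => n; rewrite /S x_def ascE// -asc_form_sum//.
  by rewrite -!mulrA mulrCA.
exact: sum_cvg.
Qed.
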